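(* For every finite abelian group $G$ we have $\mathsf{dcd}(G)=\mathsf{d}^*(G)$.
   Context: For a finite group $G$, a subset $B\subseteq G$ and an element $g$ of the subgroup $\langle B\rangle$ generated by $B$, let $\ell_B(g)$ be the minimal $n\in\mathbb{Z}_{\ge 0}$ such that $g$ is a product of $n$ (not necessarily distinct) elements of $B$ (inverses are not allowed unless they lie in $B$; $\ell_B(1_G)=0$). The directed Cayley diameter of $G$ is $\mathsf{dcd}(G):=\max\{\ell_B(g)\mid g\in G,\ B\subseteq G,\ \langle B\rangle=G\}$; equivalently, it is the maximum, over generating subsets $B$ of $G$, of the diameter of the directed Cayley graph of $G$ with respect to $B$ (with a directed edge from $g$ to $gb$ for all $g\in G$, $b\in B$). For a finite abelian group $G\cong C_{n_1}\oplus\cdots\oplus C_{n_r}$ with $2\le n_1\mid n_2\mid\dots\mid n_r$ (where $C_n$ is the cyclic group of order $n$, and $r=0$ for the trivial group), set $\mathsf{d}^*(G):=\sum_{i=1}^r(n_i-1)$. *)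

(* Defs.v *)
From mathcomp Require Import all_boot all_fingroup all_solvable.

Set Implicit Arguments.
Unset Strict Implicit.
Unset Printing Implicit Defensive.

Local Open Scope group_scope.

Section DirectedCayleyDiameter.

Variable gT : finGroupType.
Implicit Types (B : {set gT}) (G : {group gT}) (g : gT) (n : nat).

Definition is_word B g n : bool :=
  [exists c : {ffun 'I_n -> gT},
     [forall i, c i \in B] && (g == \prod_(i < n) c i)].

Lemma word_length_subproof B g : exists n, (g \in <<B>>) ==> is_word B g n.
Proof.
case Bg: (g \in <<B>>); last by exists 0.
have [n [c Bc ->]] := gen_prodgP Bg.
exists n; apply/existsP; exists (finfun c); apply/andP; split.
  by apply/forallP=> i; rewrite ffunE Bc.
by apply/eqP/eq_bigr=> i _; rewrite ffunE.
Qed.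

(* Only meaningful for g in <<B>>; the guard makes it 0 elsewhere. *)
Definition word_length B g : nat := ex_minn (word_length_subproof B g).

Lemma word_lengthP B g :
  g \in <<B>> ->
  is_word B g (word_length B g) /\
  (forall n, is_word B g n -> word_length B g <= n).
Proof.
rewrite /word_length => Bg; case: ex_minnP => m; rewrite Bg /= => Bgm min_m.
by split=> // n Bgn; apply: min_m.
Qed.

Definition dcd G : nat :=
  \max_(B : {set gT} | (B \subset G) && (<<B>> == G))
    \max_(g in G) word_length B g.

(* abelian_type G lists the invariant factors in decreasing order
   n_r, ..., n_1; see d_starE. *)
Definition d_star G : nat := \sum_(n <- abelian_type G) (n - 1).

End DirectedCayleyDiameter.

Lemma dvdn_chain_inj (s t : seq nat) :
    sorted [rel m n | n %| m] s -> sorted [rel m n | n %| m] t ->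
    all (fun m => 1 < m) s -> all (fun m => 1 < m) t ->
    (forall p n, count (fun m => n < logn p m) s =
                 count (fun m => n < logn p m) t) ->
  s = t.
Proof.
have tr : transitive [rel m n : nat | n %| m].
  by move=> x y z /= xy zx; apply: dvdn_trans zx xy.
have nil_chain u : all (fun m => 1 < m) u ->
    (forall p n, count (fun m => n < logn p m) u = 0) -> u = [::].
  case: u => //= m u /andP[m_gt1 _] /(_ (pdiv m) 0).
  by rewrite logn_gt0 pi_pdiv m_gt1.
elim: s t => [|m s IHs] [|m' t] //.
- by move=> _ _ _ t_gt1 eq_c; symmetry; apply: nil_chain => // p n; rewrite -eq_c.
- by move=> _ _ s_gt1 _ eq_c; apply: nil_chain.
have head x u p n : path [rel m n | n %| m] x u -> 1 < x ->
    (0 < count (fun m => n < logn p m) (x :: u)) = (n < logn p x).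
  move=> xu x_gt1 /=; rewrite addn_gt0 lt0b -has_count.
  case: (ltnP n) => //= le_xn; apply/negbTE/hasPn=> y uy; rewrite -leqNgt.
  apply: leq_trans le_xn; apply: dvdn_leq_log; first exact: ltnW.
  by move/(order_path_min tr)/allP: xu => /(_ y uy).
move=> /= ms m't /andP[m_gt1 s_gt1] /andP[m'_gt1 t_gt1] eq_c.
have eq_m : m = m'.
  apply: eqn_from_log; try exact: ltnW.
  move=> p; apply/eqP; rewrite eqn_leq; apply/andP; split; rewrite leqNgt.
    by rewrite -(head m s) //= eq_c (head m' t) //= ltnn.
  by rewrite -(head m' t) //= -eq_c (head m s) //= ltnn.
rewrite -eq_m in eq_c *; congr (_ :: _); apply: IHs => //.
- exact: path_sorted ms.
- exact: path_sorted m't.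
- by move=> p n; apply/(@addnI (n < logn p m)); apply: eq_c.
Qed.

Lemma d_starE (gT : finGroupType) (G : {group gT}) (b : seq gT) :
    \big[dprod/1]_(x <- b) <[x]> = G ->
    all (fun n => 2 <= n) (map order b) -> sorted dvdn (map order b) ->
  d_star G = \sum_(x <- b) (#[x] - 1).
Proof.
move=> defG b_gt1 b_dvd.
have cGG : abelian G.
  elim: b {b_gt1 b_dvd} G defG => [|x b IHb] G.
    by rewrite big_nil => <-; apply: abelian1.
  rewrite big_cons; case/dprodP=> [[_ H _ defH]] <-; rewrite defH => cxH _.
  by rewrite abelianM cycle_abelian (IHb _ defH).
have [b' defG' def_t] := abelian_structure cGG.
suffices -> : d_star G = \sum_(n <- rev (map order b)) (n - 1).
  by rewrite big_rev big_map.
rewrite /d_star; congr (\sum_(n <- _) _); apply: dvdn_chain_inj.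
- exact: abelian_type_dvdn_sorted.
- by rewrite rev_sorted.
- exact: abelian_type_gt1.
- by rewrite all_rev.
move=> p n; rewrite -def_t count_rev !count_map.
have cnt := @count_logn_dprod_cycle _ p n _ G.
exact: etrans (cnt _ defG') (esym (cnt _ defG)).
Qed.

(* Main.v *)
(** The upper bound is proved by induction on a generating set [B].  Remove
    [a] from [B], let [H] be generated by the rest and let [m] be the index
    of [H] in [G].  As [G / H] is cyclic and generated by the class of [a],
    every element of [G] is [a ^+ i * h] with [i < m] and [h] in [H], so it
    suffices that [d_star H + (m - 1) <= d_star G].  Write
    [s_0, s_1, ...] and [t_0, t_1, ...] for the invariant factors of [G] and
    [H] in decreasing order.  Since [s_i %| d] if and only if the group of
    [d]-th powers of [G] has rank at most [i], and adding one generator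
    increases ranks by at most one, they interlace: [t_i %| s_i] and
    [s_(i+1) %| t_i].  With [q_i = s_i / t_i], whose product is [m], the
    inequality becomes [m + \sum_i t_i <= 1 + \sum_i s_i], which follows by
    induction on the length, along with [m <= s_0].

    For the lower bound, take for [B] a basis [x_1, ..., x_r]: a word for
    [\prod_i x_i ^+ (n_i - 1)] contains [x_i] a number of times congruent to
    [n_i - 1] modulo [n_i]. *)
Require Import Defs.
From mathcomp Require Import all_boot all_fingroup all_solvable.
From mathcomp Require Import zify.

Set Implicit Arguments.
Unset Strict Implicit.
Unset Printing Implicit Defensive.

Local Open Scope group_scope.

(** * An inequality for interlacing sequences *)

Lemma interlacing_prod_sum N (s t q : nat -> nat) :
    (forall i, s i = q i * t i)%N -> (forall i, 0 < s i) ->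
    (forall i, s i.+1 <= t i) ->
  \prod_(i < N) q i <= s 0 /\
  (\prod_(i < N) q i + \sum_(i < N) t i <= 1 + \sum_(i < N) s i)%N.
Proof.
elim: N s t q => [|N IHN] s t q def_s s_gt0 s_le_t.
  by rewrite !big_ord0 s_gt0.
have [] := IHN (s \o S) (t \o S) (q \o S) => //=.
rewrite !big_ord_recl /=; set m := (\prod_(i < N) _)%N => m_le sum_le.
have {}m_le: m <= t 0 by apply: leq_trans m_le (s_le_t 0).
have q_gt0: 0 < q 0 by have:= s_gt0 0; rewrite def_s muln_gt0 => /andP[].
split; first by rewrite def_s leq_mul2l m_le orbT.
rewrite def_s; case: (q 0) q_gt0 => // k _; rewrite !mulSn.
(* With [q 0] equal to [k.+1], the new first terms add [k * m + t 0] on the left and [k * t 0 + t 0]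
   on the right. Hence the bound on the product is carried along in the induction. *)
have: k * m <= k * t 0 by rewrite leq_mul2l m_le orbT.
move: sum_le; set S1 := (\sum_(i < N) t _)%N; set S2 := (\sum_(i < N) s _)%N.
by rewrite -/S1 -/S2; lia.
Qed.

(** A group and a subgroup may have different numbers of invariant factors; padding with a neutral
    default indexes both by the same range. *)
Lemma big_seq_pad (R : Type) (idx : R) (op : Monoid.law idx) (T : Type)
    (x0 : T) (F : T -> R) (s : seq T) N :
    F x0 = idx -> size s <= N ->
  \big[op/idx]_(x <- s) F x = \big[op/idx]_(i < N) F (nth x0 s i).
Proof.
move=> Fx0 le_sN; rewrite -(big_mkord xpredT (fun i => F (nth x0 s i))).
rewrite (big_cat_nat (leq0n _) le_sN) //= -(big_nth x0 xpredT F).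
rewrite [X in op _ X]big_nat [X in op _ X]big1 ?Monoid.mulm1 //.
by move=> i /andP[le_si _]; rewrite nth_default.
Qed.

(** * Ranks of groups of [d]-th powers *)

Section AbelianGroups.

Variable gT : finGroupType.
Implicit Types (G H K : {group gT}) (B : {set gT}) (b w : seq gT) (a g x : gT).

(** The closure makes this a group for any [A]; in an abelian group the [d]-th powers already form a
    subgroup. *)
Definition power_group d (A : {set gT}) : {group gT} :=
  <<[set x ^+ d | x in A]>>%G.

Lemma mem_power_group d (A : {set gT}) x :
  x \in A -> x ^+ d \in power_group d A.
Proof. by move=> Ax; rewrite mem_gen //; apply: imset_f. Qed.

Lemma power_groupS d (A1 A2 : {set gT}) :
  A1 \subset A2 -> power_group d A1 \subset power_group d A2.
Proof. by move=> sA12; rewrite genS ?imsetS. Qed.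

Lemma power_group_sub d G : power_group d G \subset G.
Proof.
by rewrite gen_subG; apply/subsetP=> _ /imsetP[x Gx ->]; apply: groupX.
Qed.

Lemma power_group_abelian d G : abelian G -> abelian (power_group d G).
Proof. exact/abelianS/power_group_sub. Qed.

Lemma power_group_dprod_sub d b G K :
    \big[dprod/1]_(x <- b) <[x]> = G -> {in b, forall x, x ^+ d \in K} ->
  power_group d G \subset K.
Proof.
move=> defG Kb; rewrite gen_subG; apply/subsetP=> _ /imsetP[g Gg ->].
elim: b G defG Kb g Gg => [|x b IHb] G.
  by rewrite big_nil => <- _ g /set1gP->; rewrite expg1n group1.
rewrite big_cons => defG Kb g Gg.
have [[_ H _ defH] _ cxH _] := dprodP defG.
have [_ [h [/cycleP[k ->] Hh -> _]]] := mem_dprod defG Gg.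
rewrite expgMn; last first.
  apply/commute_sym/(centsP cxH); rewrite ?mem_cycle //.
rewrite groupM //.
  by rewrite -expgM mulnC expgM groupX // Kb ?mem_head.
by apply: (IHb H) => // [y yb|]; [rewrite Kb // inE yb orbT | rewrite -defH].
Qed.

(** The [p]-rank is additive over direct products, and each [<[x ^+ d]>] of order divisible by [p]
    contributes at least 1. *)
Lemma leq_count_p_rank p d b G : prime p ->
    \big[dprod/1]_(x <- b) <[x]> = G ->
  count (fun x => p %| #[x ^+ d]) b <= 'r_p(power_group d G).
Proof.
move=> p_pr; elim: b G => [|x b IHb] G //=.
rewrite big_cons => defG; have [[_ H _ defH] mulG cxH tiH] := dprodP defG.
rewrite defH in mulG cxH tiH.
have sPH := power_group_sub d H.
have cxP: power_group d H \subset 'C(<[x ^+ d]>).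
  by apply: subset_trans sPH _; apply: subset_trans cxH (centS (cycleX _ _)).
have tiP: <[x ^+ d]> :&: power_group d H = 1.
  by apply/trivgP; rewrite -tiH setISS ?cycleX.
have /p_rank_dprod rP := dprodEY cxP tiP.
have le_x: (p %| #[x ^+ d]) <= 'r_p(<[x ^+ d]>).
  case p_x: (p %| _) => //=.
  by rewrite p_rank_gt0 mem_primes p_pr cardG_gt0.
apply: leq_trans (leq_add le_x (IHb H defH)) _.
rewrite rP p_rankS // join_subG cycle_subG mem_power_group; last first.
  by rewrite -mulG -[x in x \in _]mulg1 mem_mulg ?cycle_id ?group1.
by apply: power_groupS; rewrite -mulG mulG_subr.
Qed.

Lemma rank_seq_leq (s : seq gT) K :
  abelian K -> K \subset <<[set:: s]>> -> abelian <<[set:: s]>> ->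
  'r(K) <= size s.
Proof.
move=> cKK sKs css; apply: leq_trans (rankS sKs) _.
rewrite -grank_abelian //; apply: leq_trans (grank_min _) _.
by rewrite cardsE card_size.
Qed.

Lemma abelian_type_nth_dvdn G i j :
  i <= j -> nth 1%N (abelian_type G) j %| nth 1%N (abelian_type G) i.
Proof.
move=> le_ij.
case: (ltnP j (size (abelian_type G))) => [lt_j | ge_j]; last first.
  by rewrite nth_default ?dvd1n.
have tr: transitive [rel m n | n %| m].
  by move=> x y z /= xy zx; apply: dvdn_trans zx xy.
have refl: reflexive [rel m n | n %| m] by move=> n /=.
apply: (sorted_leq_nth tr refl 1%N (abelian_type_dvdn_sorted G)) => //.
by rewrite inE (leq_ltn_trans le_ij).
Qed.

(* Characterizes the invariant factors of [G] by ranks of subgroups, and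
   so makes them comparable with those of a subgroup. *)
Lemma rank_power_group_leq d G i : abelian G ->
  ('r(power_group d G) <= i) = (nth 1%N (abelian_type G) i %| d).
Proof.
move=> cGG; have [b defG def_t] := abelian_structure cGG.
have sz_b: size b = size (abelian_type G) by rewrite -def_t size_map.
have ord_b j: #[nth 1 b j] = nth 1%N (abelian_type G) j.
  case: (ltnP j (size b)) => lt_j; last by rewrite !nth_default ?order1 -?sz_b.
  by rewrite -def_t (nth_map 1).
have sbG: {subset b <= G}.
  move=> x xb; rewrite -(bigdprodWY defG) mem_gen //.
  by rewrite (big_rem x) //= inE cycle_id.
apply/idP/idP => [le_r|dv_d].
  apply: contraLR le_r => ndv_d; rewrite -ltnNge.
  have lt_i: i < size b.
    by apply: contraR ndv_d; rewrite -leqNgt sz_b => ?;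
      rewrite nth_default ?dvd1n.
  (* The prime [p] divides the order of the [d]-th power of basis element [i]. As the invariant
     factors form a divisibility chain, it does so for all indices up to [i], giving [p]-rank at
     least [i + 1]. *)
  pose p := pdiv #[nth 1 b i ^+ d].
  have xd_n1: 1 < #[nth 1 b i ^+ d].
    by rewrite order_gt1 -order_dvdn ord_b.
  have p_pr: prime p by apply: pdiv_prime.
  apply: leq_trans (p_rank_le_rank p _).
  apply: leq_trans (leq_count_p_rank d p_pr defG).
  rewrite -[b in count _ b](cat_take_drop i.+1) count_cat.
  apply: leq_trans (leq_addr _ _).
  rewrite (_ : count _ _ = size (take i.+1 b)); first by rewrite size_takel.
  apply/eqP; rewrite -all_count; apply/(all_nthP 1) => j.
  rewrite size_takel // => lt_j; rewrite nth_take //.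
  apply: dvdn_trans (pdiv_dvd _) _.
  have /dvdnP[k def_k] := abelian_type_nth_dvdn G (lt_j : j <= i).
  rewrite -!ord_b in def_k.
  (* Write [x_j] for [nth 1 b j]. Since [x_j ^+ k] has the order of [x_i], the order of [x_i ^+ d]
     is that of [x_j ^+ (d * k)], which divides that of [x_j ^+ d]. *)
  have ord_k: #[nth 1 b j ^+ k] = #[nth 1 b i].
    rewrite orderXdiv def_k ?dvdn_mulr // mulKn //.
    by have:= order_gt0 (nth 1 b j); rewrite def_k muln_gt0 => /andP[].
  rewrite orderXgcd -ord_k -orderXgcd -expgM mulnC expgM; exact: orderXdvd.
have cPP := power_group_abelian d cGG.
(* Basis elements of index at least [i] are killed by [d], so the [d]-th powers of the first [i]
   suffice as generators. *)
pose s := take i [seq x ^+ d | x <- b].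
have sz_s: size s <= i by rewrite size_take; case: ltnP.
have ssG: <<[set:: s]>> \subset G.
  rewrite gen_subG; apply/subsetP=> y; rewrite inE => /mem_take/mapP[x xb ->].
  by rewrite groupX ?sbG.
apply: leq_trans sz_s; apply: rank_seq_leq => //; last exact: abelianS cGG.
apply: (power_group_dprod_sub defG) => x xb.
rewrite -(nth_index 1 xb); set j := index x b.
have lt_j: j < size b by rewrite index_mem.
case: (ltnP j i) => [lt_ji | le_ij].
  rewrite mem_gen // inE; apply/(nthP 1); exists j.
    by rewrite size_take size_map; case: ifP.
  by rewrite nth_take // (nth_map 1).
suffices /eqP->: nth 1 b j ^+ d == 1 by apply: group1.
rewrite -order_dvdn ord_b; apply: dvdn_trans dv_d.
exact: abelian_type_nth_dvdn.
Qed.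

(** * Interlacing of invariant factors *)

Lemma abelian_type_sub_dvdn H G i : abelian G -> H \subset G ->
  nth 1%N (abelian_type H) i %| nth 1%N (abelian_type G) i.
Proof.
move=> cGG sHG; rewrite -rank_power_group_leq ?(abelianS sHG) //.
apply: leq_trans (rankS (power_groupS _ sHG)) _.
by rewrite rank_power_group_leq.
Qed.

(** For [d] the entry of [H] at index [i], the [d]-th powers of [H] need at most [i] generators;
    together with [a ^+ d] these generate a group containing the [d]-th powers of [G]. *)
Lemma abelian_type_cyclic_ext_dvdn H G a i : abelian G -> H \subset G ->
    G \subset <[a]> * H -> a \in G ->
  nth 1%N (abelian_type G) i.+1 %| nth 1%N (abelian_type H) i.
Proof.
move=> cGG sHG sG Ga; rewrite -rank_power_group_leq //.
have cHH := abelianS sHG cGG.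
set d := nth _ _ _.
have: 'r(power_group d H) <= i by rewrite rank_power_group_leq.
have [B genB cardB] := grank_witness (power_group d H).
rewrite -grank_abelian ?power_group_abelian // -cardB => le_Bi.
have sBG: B \subset G.
  apply: subset_trans (subset_gen B) _; rewrite genB.
  exact: subset_trans (power_group_sub d H) sHG.
have sadBG: <<a ^+ d |: B>> \subset G.
  by rewrite gen_subG subUset sub1set groupX.
apply: leq_trans (_ : 'r(<<a ^+ d |: B>>) <= _).
  apply: rankS; rewrite gen_subG; apply/subsetP=> _ /imsetP[g Gg ->].
  have /mulsgP[_ h /cycleP[k ->] Hh ->] := subsetP sG g Gg.
  rewrite expgMn; last first.
    by apply: (centsP cGG); [apply: groupX | apply: (subsetP sHG)].
  rewrite groupM //.
    by rewrite -expgM mulnC expgM groupX // mem_gen ?setU11.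
  apply: (subsetP (genS (subsetUr [set a ^+ d] B))).
  by rewrite genB; apply: mem_power_group.
rewrite -grank_abelian; last exact: abelianS cGG.
apply: leq_trans (grank_min _) _; rewrite cardsU1.
by apply: leq_trans (leq_add (leq_b1 _) le_Bi) _.
Qed.

Lemma prod_abelian_type G N : abelian G -> size (abelian_type G) <= N ->
  (\prod_(i < N) nth 1 (abelian_type G) i)%N = #|G|.
Proof.
move=> cGG le_N; have [b defG def_t] := abelian_structure cGG.
rewrite -(bigdprod_card defG) -(big_map order xpredT id) def_t; apply/esym.
exact: (@big_seq_pad _ _ muln _ 1%N id).
Qed.

Lemma abelian_type_nth_gt0 G i : 0 < nth 1%N (abelian_type G) i.
Proof.
case: (ltnP i (size (abelian_type G))) => [lt_i | ge_i]; last first.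
  by rewrite nth_default.
by apply: ltnW; apply: (allP (abelian_type_gt1 G)); apply: mem_nth.
Qed.

(** Adding [N] undoes the truncated subtractions; each padding entry is 1 and contributes 0 to
    [d_star]. *)
Lemma d_star_pad G N : size (abelian_type G) <= N ->
  (d_star G + N = \sum_(i < N) nth 1 (abelian_type G) i)%N.
Proof.
move=> le_N.
have -> : d_star G = \sum_(i < N) (nth 1 (abelian_type G) i - 1).
  exact: (@big_seq_pad _ _ addn _ 1%N (fun n => n - 1)).
have def_N : \sum_(i < N) 1 = N by rewrite sum1_card card_ord.
rewrite -[X in _ + X]def_N -big_split /=.
by apply: eq_bigr => i _; rewrite subnK ?abelian_type_nth_gt0.
Qed.

Lemma d_star_cyclic_ext H G a : abelian G -> H \subset G ->
    G \subset <[a]> * H -> a \in G ->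
  d_star H + (#|G : H| - 1) <= d_star G.
Proof.
move=> cGG sHG sG Ga; have cHH := abelianS sHG cGG.
pose s i := nth 1%N (abelian_type G) i; pose t i := nth 1%N (abelian_type H) i.
pose N := size (abelian_type G).
have le_H: size (abelian_type H) <= N by rewrite /N !size_abelian_type ?rankS.
have def_s i: s i = (s i %/ t i * t i)%N.
  by rewrite divnK // abelian_type_sub_dvdn.
have [] := @interlacing_prod_sum N s t (fun i => s i %/ t i) def_s.
- by move=> i; apply: abelian_type_nth_gt0.
- move=> i; apply: dvdn_leq (abelian_type_nth_gt0 _ _) _.
  exact: abelian_type_cyclic_ext_dvdn sG Ga.
move=> _; rewrite -!d_star_pad //.
(* After multiplication by [#|H|], the product of the [t i], both sides become the product of the
   [s i], which is [#|G|]. *)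
suffices ->: (\prod_(i < N) (s i %/ t i))%N = #|G : H|.
  have := indexg_gt0 G H; case: #|G : H| => // m _.
  by rewrite subn1 addSn add1n ltnS addnA leq_add2r addnC.
apply/eqP; rewrite -(eqn_pmul2r (cardG_gt0 H)) -{1}(prod_abelian_type cHH le_H).
rewrite -big_split /= mulnC Lagrange // -(prod_abelian_type cGG (leqnn _)).
by apply/eqP; apply: eq_bigr => i _; rewrite -def_s.
Qed.

(** * Words and the upper bound *)

Lemma is_wordP B g n :
  reflect (exists2 w, all [in B] w & size w = n /\ \prod_(x <- w) x = g)
          (is_word B g n).
Proof.
apply: (iffP existsP) => [[c /andP[/forallP Bc /eqP->]] | [w Bw [<- <-]]].
  exists (codom c); last first.
    by rewrite size_codom card_ord codomE big_map enumT [index_enum _]unlock.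
  by apply/allP=> _ /codomP[i ->]; apply: Bc.
exists [ffun i => tnth (in_tuple w) i]; apply/andP; split.
  by apply/forallP=> i; rewrite ffunE (allP Bw) ?mem_tnth.
by rewrite big_tnth; apply/eqP/eq_bigr=> i _; rewrite ffunE.
Qed.

Lemma prod_nseq a n : \prod_(x <- nseq n a) x = a ^+ n.
Proof. by elim: n => [|n IHn]; rewrite ?big_nil //= big_cons IHn expgS. Qed.

Lemma exists_short_word B : abelian <<B>> -> forall g, g \in <<B>> ->
  exists2 w, all [in B] w & size w <= d_star <<B>>%G /\ \prod_(x <- w) x = g.
Proof.
move: {2}#|B| (erefl #|B|) => n; elim: n B => [|n IHn] B.
  move/cards0_eq=> -> _ g; rewrite gen0 => /set1gP->.
  by exists [::] => //; rewrite big_nil.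
move=> card_B cBB g Bg.
have /card_gt0P[a Ba]: 0 < #|B| by rewrite card_B.
have sDB: B :\ a \subset B := subsetDl _ _.
have sHG: <<B :\ a>> \subset <<B>> := genS sDB.
have Ga: a \in <<B>> by apply: mem_gen.
have nHG: <<B>> \subset 'N(<<B :\ a>>).
  exact: subset_trans (sub_abelian_cent cBB sHG) (cent_sub _).
have nHa := subsetP nHG a Ga.
have sG: <<B>> \subset <[a]> * <<B :\ a>>.
  rewrite -norm_joinEl ?cycle_subG // -{1}(setD1K Ba) gen_subG subUset.
  rewrite sub1set (subsetP (joing_subl _ _)) ?cycle_id //=.
  exact: subset_trans (subset_gen _) (joing_subr _ _).
have cycGH: <<B>> / <<B :\ a>> = <[coset <<B :\ a>> a]>.
  rewrite -quotient_cycle //; apply/eqP; rewrite eqEsubset.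
  rewrite [X in _ && X]quotientS ?cycle_subG // andbT.
  by rewrite -quotientMidr quotientS.
have: coset <<B :\ a>> g \in <[coset <<B :\ a>> a]>.
  by rewrite -cycGH mem_quotient.
(* The least exponent [i] is below the order of the class of [a], which is the index of
   [<<B :\ a>>]; so [a] is used at most index minus one times. *)
case/cyclePmin=> i; rewrite {1}/order -cycGH card_quotient // => lt_i.
rewrite -morphX // => eq_g.
have [||h Hh def_g] := kercoset_rcoset _ _ eq_g.
- exact: (subsetP nHG).
- by rewrite groupX.
have [|w Bw [le_w def_h]] := IHn (B :\ a) _ (abelianS sHG cBB) h Hh.
  by move: card_B; rewrite (cardsD1 a) Ba => -[].
exists (w ++ nseq i a).
  rewrite all_cat all_nseq /= Ba orbT andbT.
  by apply: sub_all Bw => x; apply: (subsetP sDB).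
rewrite size_cat size_nseq big_cat def_h /= prod_nseq.
split=> //; apply: leq_trans (d_star_cyclic_ext cBB sHG sG Ga).
by rewrite leq_add // leq_subRL ?add1n // indexg_gt0.
Qed.

(** * The lower bound: words over a basis *)

Lemma word_split a w :
    {in w, forall x, commute a x} ->
  exists k, exists2 w', {subset w' <= [predD1 w & a]} &
    size w = (k + size w')%N /\ \prod_(x <- w) x = a ^+ k * \prod_(x <- w') x.
Proof.
elim: w => [|x w IHw] caw; first by exists 0, [::]; rewrite ?big_nil ?mul1g.
have [y wy|k [w' sw' [sz_w def_w]]] := IHw.
  by apply: caw; rewrite inE wy orbT.
have [-> | xa] := eqVneq x a.
  exists k.+1, w'; last by rewrite big_cons def_w /= sz_w expgS mulgA.
  by move=> y /sw'; rewrite !inE => /andP[-> ->]; rewrite orbT.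
exists k, (x :: w').
  move=> y; rewrite !inE => /orP[/eqP-> | /sw']; first by rewrite xa eqxx.
  by rewrite !inE => /andP[-> ->]; rewrite orbT.
rewrite !big_cons def_w /= sz_w addnS; split=> //; rewrite !mulgA.
by congr (_ * _); apply: (commuteX k (commute_sym (caw x (mem_head x w)))).
Qed.

Lemma basis_word_size b G w :
    \big[dprod/1]_(x <- b) <[x]> = G -> all [in b] w ->
    \prod_(x <- w) x = \prod_(x <- b) x ^+ (#[x] - 1) ->
  \sum_(x <- b) (#[x] - 1) <= size w.
Proof.
elim: b G w => [|x b IHb] G w; first by rewrite !big_nil.
rewrite !big_cons => defG /allP bw.
have [[_ H _ defH] mulG cxH tiH] := dprodP defG.
rewrite defH in mulG cxH tiH.
have sbH: {subset b <= H}.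
  move=> y yb; rewrite -(bigdprodWY defH) mem_gen //.
  by rewrite (big_rem y) //= inE cycle_id.
have [y wy|k [w' sw' [-> ->]]] := @word_split x w.
  have:= bw y wy; rewrite inE => /orP[/eqP-> // | yb].
  by apply/commute_sym/(centsP cxH); rewrite ?cycle_id ?sbH.
have bw': all [in b] w'.
  apply/allP=> y /sw'; rewrite !inE => /andP[yx /bw].
  by rewrite inE (negPf yx).
have Hw': \prod_(y <- w') y \in H.
  by rewrite big_seq group_prod // => y /(allP bw')/sbH.
have Hb: \prod_(y <- b) y ^+ (#[y] - 1) \in H.
  by rewrite big_seq group_prod // => y /sbH Hy; apply: groupX.
move=> eq_g.
have [eq_x eq_h]: x ^+ k = x ^+ (#[x] - 1) /\
    \prod_(y <- w') y = \prod_(y <- b) y ^+ (#[y] - 1).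
  have: x ^+ (#[x] - 1) \in <[x]> by apply: mem_cycle.
  have: x ^+ k \in <[x]> by apply: mem_cycle.
  move: (x ^+ k) (x ^+ (#[x] - 1)) eq_g => u v eq_uv xu xv.
  (* This element lies in [<[x]>] and, by [eq_uv], also in [H]; these meet trivially. *)
  have uv1: v^-1 * u = 1.
    apply/set1gP; rewrite -tiH inE groupM ?groupV //=.
    have ->: v^-1 * u = \prod_(y <- b) y ^+ (#[y] - 1) * (\prod_(y <- w') y)^-1.
      by apply: (mulgI v); rewrite mulKVg mulgA -eq_uv mulgK.
    by rewrite groupM ?groupV.
  have def_u: u = v by rewrite -[u]mul1g -(mulgV v) -mulgA uv1 mulg1.
  by split=> //; apply: (mulgI v); rewrite -eq_uv def_u.
apply: leq_add (IHb H w' defH bw' eq_h).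
(* [#[x] - 1] is its own residue modulo [#[x]], hence the residue of [k], and a residue never
   exceeds the number itself. *)
have /eqP := eq_x; rewrite eq_expg_mod_order => /eqP eq_k.
rewrite -(modn_small (_ : #[x] - 1 < #[x])) -?eq_k ?leq_mod //.
by rewrite subn1 prednK.
Qed.

End AbelianGroups.

Theorem theorem3p2 (gT : finGroupType) (G : {group gT}) (cGG : abelian G) :
  dcd G = d_star G.
Proof.
apply/eqP; rewrite eqn_leq; apply/andP; split.
  apply/bigmax_leqP=> B /andP[sBG /eqP genB]; apply/bigmax_leqP=> g Gg.
  have defG: <<B>>%G = G by apply: val_inj.
  rewrite -genB in cGG Gg.
  have [w Bw [le_w def_g]] := exists_short_word cGG Gg.
  have [_ min_g] := word_lengthP Gg; rewrite -defG.
  by apply: leq_trans le_w; apply: min_g; apply/is_wordP; exists w.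
have [b defG def_t] := abelian_structure cGG.
pose B := [set:: b]; pose g := \prod_(x <- b) x ^+ (#[x] - 1).
have sBG: B \subset G.
  apply/subsetP=> x; rewrite inE => xb; rewrite -(bigdprodWY defG) mem_gen //.
  by rewrite (big_rem x) //= inE cycle_id.
have genB: <<B>> = G.
  apply/eqP; rewrite eqEsubset gen_subG sBG -(bigdprodWY defG) gen_subG /=.
  rewrite big_seq; apply: (big_ind (fun A : {set gT} => A \subset <<B>>)) => //.
  - exact: sub0set.
  - by move=> A1 A2 sA1 sA2; rewrite subUset sA1.
  by move=> x xb; rewrite cycle_subG mem_gen // inE.
have Gg: g \in G.
  rewrite /g big_seq group_prod // => x xb.
  by rewrite groupX // (subsetP sBG) // inE.
have Bg: g \in <<B>> by rewrite genB.
have [/is_wordP[w Bw [sz_w def_g]] _] := word_lengthP Bg.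
have ->: d_star G = \sum_(x <- b) (#[x] - 1) by rewrite /d_star -def_t big_map.
apply: leq_trans (_ : word_length B g <= _).
  rewrite -sz_w; apply: basis_word_size defG _ def_g.
  by apply: sub_all Bw => x; rewrite !inE.
rewrite /dcd (bigmax_sup B) ?sBG ?genB ?eqxx //.
exact: (leq_bigmax_cond (F := fun g => word_length B g) g).
Qed.
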